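(* Let $(\mathbf{C},p,\mathbf{Q})$ be a generalized Brascamp-Lieb datum. Then $\mathrm{BL}(\mathbf{C},p,\mathbf{Q})<+\infty$ if and only if for every linear subspace $V\subset H$, $$\dim(V)\le\sum_{j=1}^m p_j\dim(C_jV).$$ More generally, if $\mathcal{Q}:H\to H$ is positive semi-definite and not positive definite, then $\mathrm{BL}(\mathbf{C},p,\mathbf{Q},\mathcal{Q})<+\infty$ if and only if for every linear subspace $V\subset\ker(\mathcal{Q})$, $$\dim(V)\le\sum_{j=1}^m p_j\dim(C_jV).$$
   Context: A generalized Brascamp-Lieb datum $(\mathbf{C},p,\mathbf{Q})$ consists of: Euclidean spaces (finite-dimensional real Hilbert spaces) $H,H_1,\dots,H_m$; surjective linear maps $C_i:H\to H_i$ with $\bigcap_{i=1}^m\ker(C_i)=\{0\}$ (collected in $\mathbf{C}$); exponents $p=(p_1,\dots,p_m)$ with $p_i>0$; and positive definite self-adjoint maps $Q_i:H_i\to H_i$, $\mathbf{Q}=(Q_i)_{1\le i\le m}$. For positive semi-definite $\mathcal{Q}$ on $H$, $$\mathrm{BL}(\mathbf{C},p,\mathbf{Q},\mathcal{Q})=\sup_{0<B_i\le Q_i\ (1\le i\le m)}\left\{\frac{\prod_{i=1}^m(\det B_i)^{p_i}}{\det\left(\mathcal{Q}+\sum_{i=1}^m p_iC_i^*B_iC_i\right)}\right\}^{1/2},\qquad \mathrm{BL}(\mathbf{C},p,\mathbf{Q})=\mathrm{BL}(\mathbf{C},p,\mathbf{Q},0),$$ where $B_i:H_i\to H_i$ are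 self-adjoint, $A\le B$ means $B-A$ is positive semi-definite, and $0<B_i$ means positive definite. *)

(* Defs.v *)
From HB Require Import structures.
From mathcomp Require Import all_boot all_order all_algebra.
From mathcomp Require Import all_classical all_reals all_analysis.

Set Implicit Arguments.
Unset Strict Implicit.
Unset Printing Implicit Defensive.

Import Order.TTheory GRing.Theory Num.Theory.
Import passmx.

Local Open Scope classical_set_scope.
Local Open Scope ring_scope.

Record euclidean (R : realType) := Euclidean {
  euclidean_sort :> vectType R;
  inner : {dot euclidean_sort for idfun} }.

Definition dotE (R : realType) (E : euclidean R) (x y : E) : R := inner E x y.

Notation "''[' x , y ]" := (dotE x y) : ring_scope.

Section Operators.
Variable R : realType.
Implicit Types E F : euclidean R.

Definition selfadjoint E (A : 'End(E)) : Prop :=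
  forall x y : E, '[A x, y] = '[x, A y].

Definition psd E (A : 'End(E)) : Prop :=
  selfadjoint A /\ forall x : E, 0 <= '[A x, x].

Definition posdef E (A : 'End(E)) : Prop :=
  selfadjoint A /\ forall x : E, x != 0 -> 0 < '[A x, x].

Definition loewner_le E (A B : 'End(E)) : Prop := psd (B - A).

(* The linear map [D] with <C x, y> = <x, D y>; it exists and is unique,
   see [adjointP] and [adjoint_uniq]. *)
Definition adjoint E F (C : 'Hom(E, F)) : 'Hom(F, E) :=
  xget 0 [set D : 'Hom(F, E) | forall (x : E) (y : F), '[C x, y] = '[x, D y]].

(* The determinant of the matrix of [A] in a basis of [E]; the choice of the
   basis does not matter, see [detlE]. *)
Definition detl E (A : 'End(E)) : R :=
  \det (mxof (vbasis {:E}) (vbasis {:E}) A).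

Lemma dotC E (x y : E) : '[x, y] = '[y, x].
Proof. by rewrite /dotE hermC /= expr0 mul1r. Qed.

Lemma dot_gt0 E (x : E) : x != 0 -> 0 < '[x, x].
Proof. exact: neq0_dnorm_gt0. Qed.

Lemma dotZr E a (x y : E) : '[x, a *: y] = a * '[x, y].
Proof. by rewrite /dotE linearZr_LR. Qed.

Lemma dotDr E (x y z : E) : '[x, y + z] = '[x, y] + '[x, z].
Proof. by rewrite /dotE linearDr. Qed.

Lemma dotBr E (x y z : E) : '[x, y - z] = '[x, y] - '[x, z].
Proof. by rewrite /dotE linearBr. Qed.

Lemma dot0r E (x : E) : '[x, 0] = 0.
Proof. by rewrite /dotE linear0r. Qed.

Lemma dot_sumr E (x : E) n (y : 'I_n -> E) :
  '[x, \sum_i y i] = \sum_i '[x, y i].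
Proof. by rewrite /dotE linear_sumr. Qed.

Lemma dot_suml E (x : E) n (y : 'I_n -> E) :
  '[\sum_i y i, x] = \sum_i '[y i, x].
Proof. by rewrite dotC dot_sumr; apply: eq_bigr => i _; rewrite dotC. Qed.

Let b E := vbasis {:E}.
Let bB E : basis_of {:E} (b E) := vbasisP {:E}.

Definition gram E : 'M[R]_(\dim {:E}) :=
  \matrix_(i, j) '[(b E)`_i, (b E)`_j].

Lemma dot_gram E (x y : E) :
  '[x, y] = (rVof (b E) x *m gram E *m (rVof (b E) y)^T) 0 0.
Proof.
rewrite {1}(coord_basis (bB E) (memvf y)) dot_sumr mxE.
apply: eq_bigr => j _; rewrite dotZr !mxE mulrC; congr (_ * _).
rewrite {1}(coord_basis (bB E) (memvf x)) dot_suml.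
by apply: eq_bigr => i _; rewrite dotC dotZr !mxE dotC.
Qed.

Lemma gram_unit E : gram E \in unitmx.
Proof.
rewrite -row_free_unit -kermx_eq0; apply/eqP/row_matrixP => i.
rewrite row0; set u := row i _.
have uG : u *m gram E = 0 by rewrite -row_mul mulmx_ker row0.
apply/eqP/negPn/negP => u0.
have: 0 < '[vecof (b E) u, vecof (b E) u].
  by apply: dot_gt0; rewrite -(rVof_eq0 (bB E)) vecofK ?bB.
by rewrite dot_gram vecofK ?bB// uG mul0mx mxE ltxx.
Qed.

Lemma adjointP E F (C : 'Hom(E, F)) (x : E) (y : F) :
  '[C x, y] = '[x, adjoint C y].
Proof.
rewrite /adjoint; move: x y; set P := [set D | _].
suff : exists D, P D by move=> /(xgetPex 0).
pose A := mxof (b E) (b F) C.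
exists (hommx (b F) (b E) (invmx (gram E) *m A *m gram F)^T) => x y.
rewrite !dot_gram (rVof_app (b F) (bB E)) hommxE ?vecofK ?bB//.
by rewrite trmx_mul trmxK !mulmxA mulmxK ?gram_unit.
Qed.

Lemma adjoint_uniq E F (C : 'Hom(E, F)) (D : 'Hom(F, E)) :
  (forall (x : E) (y : F), '[C x, y] = '[x, D y]) -> D = adjoint C.
Proof.
move=> CD; apply/lfunP => y; apply/eqP; rewrite -subr_eq0.
apply/negPn/negP => /dot_gt0; rewrite dotBr -CD -adjointP subrr ltxx //.
Qed.

Lemma detlE E (e : (\dim {:E}).-tuple E) (A : 'End(E)) :
  basis_of {:E} e -> detl A = \det (mxof e e A).
Proof.
move=> eB; pose P := mxof e (b E) \1%VF; pose P' := mxof (b E) e \1%VF.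
have PP' : P *m P' = 1%:M.
  rewrite -mxof_comp ?bB// comp_lfun1l; apply/row_matrixP => i.
  by rewrite !rowE mul_mxof lfunE /= vecofK// mulmx1.
have -> : mxof e e A = P *m mxof (b E) (b E) A *m P'.
  by rewrite -!mxof_comp ?bB// comp_lfun1l comp_lfun1r.
by rewrite !det_mulmx mulrAC -det_mulmx PP' det1 mul1r.
Qed.

End Operators.

(* The spaces [H] and [Hs i] of the datum are the implicit parameters. *)
Record gBL_datum (R : realType) (m : nat) (H : euclidean R)
    (Hs : 'I_m -> euclidean R) (C : forall i, 'Hom(H, Hs i)) (p : 'I_m -> R)
    (Q : forall i, 'End(Hs i)) : Prop := GBLDatum {
  gBL_surj : forall i, limg (C i) = {:Hs i}%VS;
  gBL_ker : (\bigcap_i lker (C i))%VS = 0%VS;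
  gBL_exp : forall i, 0 < p i;
  gBL_posdef : forall i, posdef (Q i) }.

Definition BL_ratio (R : realType) (m : nat) (H : euclidean R)
    (Hs : 'I_m -> euclidean R) (C : forall i, 'Hom(H, Hs i)) (p : 'I_m -> R)
    (QH : 'End(H)) (B : forall i, 'End(Hs i)) : R :=
  (\prod_i detl (B i) `^ p i) /
  detl (QH + \sum_i p i *: (adjoint (C i) \o (B i \o C i))%VF).

(* BL(C, p, Q, QH), with values in the extended reals *)
Definition BL (R : realType) (m : nat) (H : euclidean R)
    (Hs : 'I_m -> euclidean R) (C : forall i, 'Hom(H, Hs i)) (p : 'I_m -> R)
    (Q : forall i, 'End(Hs i)) (QH : 'End(H)) : \bar R :=
  ereal_sup [set (Num.sqrt (BL_ratio C p QH B))%:E |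
    B in [set B : forall i, 'End(Hs i) |
            forall i, posdef (B i) /\ loewner_le (B i) (Q i)]].

(* Main.v *)
Require Import Defs.
From HB Require Import structures.
From mathcomp Require Import all_boot all_order all_algebra.
From mathcomp Require Import all_classical all_reals all_analysis.
From mathcomp Require Import fingroup perm.
From mathcomp Require Import ring lra.

Set Implicit Arguments.
Unset Strict Implicit.
Unset Printing Implicit Defensive.

Import Order.TTheory GRing.Theory Num.Theory.
Import passmx numFieldNormedType.Exports.

Local Open Scope classical_set_scope.
Local Open Scope ring_scope.

(** The equivalence holds for every positive semi-definite [QH]; both assertions
    are instances of it, the first one with [QH = 0].  Write
      M = QH + sum_i p_i C_i^* B_i C_i.

    Necessity.  Let V be a subspace of ker QH.  Choose a complement of
    U_i = C_i V, let B_i(t) be a fixed positive definite form for which U_i and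
    this complement are orthogonal, multiplied by t on U_i, and rescale it so
    that B_i(t) <= Q_i for t <= 1.  Then det B_i(t) is a constant times
    t^(dim U_i).  On V the operator M(t) is t times a fixed operator, so
    det M(t) is t^(dim V) times a polynomial in t, which is bounded
    ([detl_affine_bounded]).  If the ratio stays bounded as t tends to 0, then
    dim V <= sum_i p_i dim U_i ([BL_finite_necessary]).

    Sufficiency.  Elimination with complete pivoting ([pdmx_ldl]) yields an
    M-orthogonal basis f_0, f_1, ... of H with values d_k = <M f_k, f_k>
    increasing in k and with det M proportional to prod_k d_k; its coordinates
    are bounded independently of M and have determinant 1 or -1, so all these
    bases lie in one compact set, and it is enough to bound the ratio for the
    bases close to a given one, f^0 ([local_bound]).  For each i, scanning
    C_i f^0_0, C_i f^0_1, ... from the left and keeping each vector outside the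
    span of the previous ones gives a set I_i of indices such that the
    C_i f^0_k, k in I_i, form a basis of H_i ([greedy_basis]).  This remains a
    basis, with a determinant bounded away from 0, for all f close to f^0.  As
    p_i <B_i C_i f_k, C_i f_k> <= d_k, it follows ([detl_le_prod]) that det B_i
    is at most a constant times the product of the d_k over I_i.  Hence the
    logarithm of the ratio is at most a constant plus
      sum_k (a_k - 1) ln d_k,   where a_k = sum of the p_i with k in I_i.
    The sum of a_j over j < k is sum_i p_i dim C_i V_k with V_k the span of
    f^0_0, ..., f^0_(k-1), so it is at least k as long as V_k lies in ker QH.
    From the first f^0_r outside ker QH on, d_k >= <QH f_r, f_r> is bounded
    below.  As the d_k are also bounded above, summation by parts bounds the
    sum ([prefix_sum_bound]). *)

(** * Positive definite matrices *)

Section PosDefMatrix.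
Variable R : realFieldType.

Definition qf n (G : 'M[R]_n) (u : 'rV[R]_n) : R := (u *m G *m u^T) 0 0.

Definition pdmx n (G : 'M[R]_n) : Prop :=
  G^T = G /\ forall u : 'rV[R]_n, u != 0 -> 0 < qf G u.

Lemma qfE n (G : 'M[R]_n) u : qf G u = \sum_i \sum_j u 0 i * u 0 j * G i j.
Proof.
rewrite /qf mxE exchange_big /=; apply: eq_bigr => j _.
by rewrite !mxE mulr_suml; apply: eq_bigr => i _; rewrite mulrAC.
Qed.

Lemma qf_diag n (d u : 'rV[R]_n) :
  qf (diag_mx d) u = \sum_i d 0 i * u 0 i ^+ 2.
Proof.
rewrite qfE; apply: eq_bigr => i _; rewrite (bigD1 i)//= big1 ?addr0.
  by rewrite mxE eqxx mulr1n mulrC expr2.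
by move=> j /negPf ji; rewrite mxE eq_sym ji mulr0n mulr0.
Qed.

Lemma qf_congr n (F G : 'M[R]_n) u : qf (F *m G *m F^T) u = qf G (u *m F).
Proof. by rewrite /qf trmx_mul !mulmxA. Qed.

Lemma qf_delta n (G : 'M[R]_n) i : qf G (delta_mx 0 i) = G i i.
Proof. by rewrite /qf -rowE trmx_delta -colE !mxE. Qed.

Lemma qf_delta2 n (G : 'M[R]_n) i j s t : G^T = G ->
  qf G (s *: delta_mx 0 i + t *: delta_mx 0 j) =
    s ^+ 2 * G i i + s * t * G i j *+ 2 + t ^+ 2 * G j j.
Proof.
move=> GT; rewrite /qf linearD/= !linearZ/= !(mulmxDl, mulmxDr).
rewrite -!(scalemxAl, scalemxAr) -!rowE !trmx_delta -!colE !mxE.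
have -> : G j i = G i j by rewrite -[in LHS]GT mxE.
by ring.
Qed.

Lemma pdmx_congr n (F G : 'M[R]_n) :
  F \in unitmx -> pdmx G -> pdmx (F *m G *m F^T).
Proof.
move=> uF [GT Gp]; split=> [|u u0]; first by rewrite !trmx_mul trmxK GT mulmxA.
rewrite qf_congr; apply: Gp; apply: contra u0 => /eqP uF0.
by rewrite -(mulmxK uF u) uF0 mul0mx.
Qed.

Lemma delta_mx_neq0 n (i : 'I_n) : delta_mx 0 i != 0 :> 'rV[R]_n.
Proof.
by apply/eqP => /rowP/(_ i); rewrite !mxE !eqxx => /eqP; rewrite oner_eq0.
Qed.

Lemma pdmx_diag_gt0 n (G : 'M[R]_n) i : pdmx G -> 0 < G i i.
Proof. by case=> _ Gp; rewrite -qf_delta Gp ?delta_mx_neq0. Qed.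

Lemma delta2_neq0 n (i j : 'I_n) (s t : R) : i != j -> s != 0 ->
  s *: delta_mx 0 i + t *: delta_mx 0 j != 0 :> 'rV[R]_n.
Proof.
move=> ij s0; apply/eqP => /rowP/(_ i); rewrite !mxE !eqxx (negPf ij) mulr1 mulr0.
by rewrite addr0 => /eqP; rewrite (negPf s0).
Qed.

Lemma pdmx_minor2 n (G : 'M[R]_n) i j : pdmx G ->
  G i j ^+ 2 <= G i i * G j j.
Proof.
move=> pG; have [->|ij] := eqVneq i j; first by rewrite expr2.
have gj := pdmx_diag_gt0 j pG; have [GT Gp] := pG.
have := Gp _ (delta2_neq0 (- G i j) ij (lt0r_neq0 gj)).
rewrite qf_delta2//.
have -> : G j j ^+ 2 * G i i + G j j * - G i j * G i j *+ 2 +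
   (- G i j) ^+ 2 * G j j = G j j * (G i i * G j j - G i j ^+ 2) by ring.
by rewrite pmulr_rgt0// subr_gt0 => /ltW.
Qed.

(** Hadamard's inequality up to the factor [n!]: by [pdmx_minor2] each term of
    the Leibniz expansion is at most the product of the diagonal entries. *)
Lemma det_le_prod_diag n (G : 'M[R]_n) : pdmx G ->
  \det G <= n`!%:R * \prod_i G i i.
Proof.
move=> pG; have p0 : 0 <= \prod_i G i i.
  by apply: prodr_ge0 => i _; apply/ltW/pdmx_diag_gt0.
have -> : n`! = #|'S_n| by rewrite card_Sn.
rewrite mulr_natl -sumr_const; apply: ler_sum => s _.
apply: le_trans (ler_norm _) _; rewrite normrM normrX normrN1 expr1n mul1r.
rewrite -(ler_pXn2r (n := 2)) ?nnegrE// -normrX -prodrXl ger0_norm; last first.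
  by apply: prodr_ge0 => i _; apply: sqr_ge0.
apply: (@le_trans _ _ (\prod_i (G i i * G (s i) (s i)))).
  by apply: ler_prod => i _; rewrite sqr_ge0 pdmx_minor2.
rewrite big_split/= expr2 (reindex_inj (@perm_inj _ s)) /=.
by rewrite [leLHS]mulrC [X in _ * X](reindex_inj (@perm_inj _ s)).
Qed.

Lemma pdmx_drsub n (a : 'M[R]_1) (S : 'M[R]_n) :
  pdmx (block_mx a 0 0 S) -> pdmx S.
Proof.
case=> GT Gp; split.
  by move: GT; rewrite tr_block_mx => /eq_block_mx[].
move=> u u0; have := Gp (row_mx 0 u); rewrite /qf mul_row_block.
rewrite !(mul0mx, mulmx0, add0r) tr_row_mx mul_row_col mul0mx add0r; apply.
by rewrite row_mx_eq0 negb_and u0 orbT.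
Qed.

(** LDL decomposition with complete pivoting: taking the largest diagonal entry
    as pivot keeps all multipliers at most 1 in absolute value, so the basis
    given by the rows of [F] stays in a bounded set whatever [G] is.  The last
    clause, applied to the Schur complement, gives the monotonicity of [d]. *)
Lemma pdmx_ldl n : exists2 c : R, 0 <= c & forall G : 'M[R]_n, pdmx G ->
  exists F : 'M[R]_n, exists d : 'rV[R]_n,
  [/\ \det F ^+ 2 = 1, forall i j, `|F i j| <= c, F *m G *m F^T = diag_mx d,
      forall i j : 'I_n, (i <= j)%N -> d 0 j <= d 0 i &
      forall a, (forall i, G i i <= a) -> forall i, d 0 i <= a].
Proof.
elim: n => [|n [c c0 IH]].
  exists 0 => // G _; exists 1%:M, 0; split; rewrite ?det1 ?expr1n//; try by case.
    by apply/matrixP; case.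
  by move=> a _ [].
(* The terms bound the three nonzero blocks of [F] below. *)
exists (1 + n%:R * c + c); first by rewrite !addr_ge0// mulr_ge0.
rewrite -[n.+1]/(1 + n)%N => G pG.
pose i0 := [arg max_(i > 0 : 'I_(1 + n)) G i i]%O.
have Gi0 i : G i i <= G i0 i0 by rewrite /i0; case: arg_maxP => // k _; apply.
pose P : 'M[R]_(1 + n) := perm_mx (tperm 0 i0).
pose G1 := P *m G *m P^T.
have uP : P \in unitmx by apply: unitmx_perm.
have pG1 : pdmx G1 by apply: pdmx_congr.
have G1E i j : G1 i j = G (tperm 0 i0 i) (tperm 0 i0 j).
  by rewrite /G1 /P -row_permE tr_perm_mx -col_permE !mxE.
pose a := G1 0 0; have a0 : 0 < a by apply: pdmx_diag_gt0.
have aE : a = G i0 i0 by rewrite /a G1E tpermL.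
have G1a i : G1 i i <= a by rewrite aE G1E.
pose b := dlsubmx G1; pose S := drsubmx G1.
have G1block : G1 = block_mx a%:M b^T b S.
  rewrite -[LHS](@submxK _ 1 n 1 n); congr block_mx.
    rewrite [LHS]mx11_scalar /a; congr (_%:M).
    by rewrite /ulsubmx [LHS]mxE [LHS]mxE; congr (G1 _ _); apply/val_inj.
  by rewrite /b trmx_dlsub; case: pG1 => ->.
(* [E] clears the first row and column; what remains is the Schur complement. *)
pose E : 'M[R]_(1 + n) := block_mx 1%:M 0 (- a^-1 *: b) 1%:M.
have uE : E \in unitmx by rewrite unitmxE det_lblock !det1 mulr1 unitr1.
pose T := S - a^-1 *: (b *m b^T).
have EG1 : E *m G1 *m E^T = block_mx a%:M 0 0 T.
  rewrite G1block /E tr_block_mx !mulmx_block !(mul0mx, mulmx0, mul1mx, mulmx1).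
  rewrite !trmx1 trmx0 !addr0 !mulmx1 linearZ/= mul_mx_scalar mul_scalar_mx !scalerA.
  rewrite mulrN divff ?lt0r_neq0// !scaleN1r.
  rewrite !addNr !(mul0mx, mulmx0, add0r, addr0) /T; congr block_mx.
  by rewrite -scalemxAl scaleNr addrC.
have pT : pdmx T.
  by apply: (@pdmx_drsub _ a%:M); rewrite -EG1; apply: pdmx_congr.
have Ta i : T i i <= a.
  have Sii : S i i = G1 (rshift 1 i) (rshift 1 i) by rewrite /S /drsubmx !mxE.
  apply: le_trans (G1a (rshift 1 i)); rewrite -Sii /T mxE.
  rewrite [X in _ + X]mxE gerDl oppr_le0 mxE mxE.
  apply: mulr_ge0; first by rewrite invr_ge0 ltW.
  by apply: sumr_ge0 => j _; rewrite !mxE -expr2 sqr_ge0.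
(* The form is positive at the sum and the difference of two basis vectors. *)
have ba i : `|b i 0| <= a.
  have := pG1 => -[G1T G1p].
  have ri : rshift 1 i != 0 :> 'I_(1 + n) by [].
  have := G1a (rshift 1 i).
  have -> : b i 0 = G1 (rshift 1 i) 0.
    by rewrite /b /dlsubmx [LHS]mxE [LHS]mxE; congr (G1 _ _); apply/val_inj.
  have := G1p _ (delta2_neq0 1 ri (oner_neq0 _)).
  have := G1p _ (delta2_neq0 (- 1) ri (oner_neq0 _)).
  rewrite !qf_delta2// -/a ler_norml; lra.
have [F' [d [dF' cF' FT dd da]]] := IH _ pT.
pose F := (block_mx 1%:M 0 0 F' : 'M[R]_(1 + n)) *m E *m P.
exists F, (row_mx a%:M d); split.
- rewrite !det_mulmx det_lblock det_lblock !det1 mul1r !mulr1 det_perm.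
  by rewrite exprMn dF' mul1r sqrr_sign.
- move=> i j.
  have -> : F i j = (block_mx 1%:M 0 (- a^-1 *: (F' *m b)) F') i (tperm 0 i0 j).
    rewrite /F /P -[tperm 0 i0 in LHS]tpermV -col_permE mxE mulmx_block.
    by rewrite !(mul0mx, mulmx0, mul1mx, mulmx1, add0r, addr0) scalemxAr.
  move: (tperm 0 i0 j : 'I_(1 + n)) => {}j.
  have n0 : 0 <= n%:R * c by rewrite mulr_ge0.
  have c1 : 1 <= 1 + n%:R * c + c by rewrite -addrA lerDl addr_ge0.
  have zc : 0 <= 1 + n%:R * c + c by apply: le_trans c1.
  case: (splitP i) => i' ii'; case: (splitP j) => j' jj'.
  + have -> : i = lshift n i' by apply/val_inj.
    have -> : j = lshift n j' by apply/val_inj.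
    by rewrite block_mxEul mxE !ord1 normr1.
  + have -> : i = lshift n i' by apply/val_inj.
    have -> : j = rshift 1 j' by apply/val_inj.
    by rewrite block_mxEur mxE normr0.
  + have -> : i = rshift 1 i' by apply/val_inj.
    have -> : j = lshift n j' by apply/val_inj.
    rewrite block_mxEdl ord1 !mxE normrM normrN normfV (gtr0_norm a0).
    apply: (@le_trans _ _ (n%:R * c)); last first.
      by rewrite addrAC lerDr addr_ge0.
    rewrite mulrC ler_pdivrMr// -mulrA mulr_natl.
    rewrite -[X in _ *+ X]card_ord -sumr_const; apply: le_trans (ler_norm_sum _ _ _) _.
    by apply: ler_sum => k _; rewrite normrM ler_pM.
  + have -> : i = rshift 1 i' by apply/val_inj.
    have -> : j = rshift 1 j' by apply/val_inj.
    rewrite block_mxEdr; apply: le_trans (cF' _ _) _.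
    by rewrite lerDr addr_ge0.
- rewrite /F !trmx_mul !mulmxA.
  have -> : block_mx 1%:M 0 0 F' *m E *m P *m G *m P^T *m E^T =
            block_mx 1%:M 0 0 F' *m (E *m G1 *m E^T) by rewrite /G1 !mulmxA.
  rewrite EG1 tr_block_mx !mulmx_block !(trmx0, trmx1).
  rewrite !(mul0mx, mulmx0, add0r, addr0, mul1mx, mulmx1) FT diag_mx_row; congr block_mx.
  by rewrite [RHS]mx11_scalar !mxE eqxx mulr1n.
- move=> i j; case: (splitP i) => i' ii'; case: (splitP j) => j' jj' ij.
  + have -> : i = lshift n i' by apply/val_inj.
    have -> : j = lshift n j' by apply/val_inj.
    by rewrite !ord1.
  + have -> : i = lshift n i' by apply/val_inj.
    have -> : j = rshift 1 j' by apply/val_inj.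
    by rewrite row_mxEl row_mxEr !ord1 mxE eqxx mulr1n da.
  + by move: ij; rewrite ii' jj' ord1.
  + have -> : i = rshift 1 i' by apply/val_inj.
    have -> : j = rshift 1 j' by apply/val_inj.
    by rewrite !row_mxEr dd//; move: ij; rewrite ii' jj' ltnS.
- move=> z Gz i.
  have az : a <= z by rewrite aE.
  case: (splitP i) => i' ii'.
    have -> : i = lshift n i' by apply/val_inj.
    by rewrite row_mxEl !ord1 mxE eqxx.
  have -> : i = rshift 1 i' by apply/val_inj.
  by rewrite row_mxEr; apply: le_trans az; apply: da.
Qed.

Lemma pdmx_ldl_det n (G F : 'M[R]_n) (d : 'rV[R]_n) :
  \det F ^+ 2 = 1 -> F *m G *m F^T = diag_mx d -> \det G = \prod_i d 0 i.
Proof.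
move=> F1 /(congr1 determinant); rewrite det_diag => <-.
by rewrite !det_mulmx det_tr mulrAC -expr2 F1 mul1r.
Qed.

Lemma det_sqr1_unit n (F : 'M[R]_n) : \det F ^+ 2 = 1 -> F \in unitmx.
Proof.
move=> F1; rewrite unitmxE unitfE; apply/eqP => F0.
by move/eqP: F1; rewrite F0 expr0n/= eq_sym oner_eq0.
Qed.

Lemma pdmx_ldl_gt0 n (G F : 'M[R]_n) (d : 'rV[R]_n) i : pdmx G ->
  \det F ^+ 2 = 1 -> F *m G *m F^T = diag_mx d -> 0 < d 0 i.
Proof.
move=> pG /det_sqr1_unit uF FG; have := pdmx_diag_gt0 i (pdmx_congr uF pG).
by rewrite FG mxE eqxx.
Qed.

Lemma pdmx_det_gt0 n (G : 'M[R]_n) : pdmx G -> 0 < \det G.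
Proof.
move=> pG; have [c _ /(_ _ pG)[F [d [F1 _ Fd _ _]]]] := pdmx_ldl n.
rewrite (pdmx_ldl_det F1 Fd); apply: prodr_gt0 => i _.
exact: pdmx_ldl_gt0 Fd.
Qed.

(** In coordinates [v] that diagonalize [G], each [v i ^+ 2] is at most the value
    of [G] divided by [d i]; this controls the products [v i * v j]. *)
Lemma pdmx_dominates n (G A : 'M[R]_n) : pdmx G ->
  exists2 e : R, 0 < e & forall u, e * qf A u <= qf G u.
Proof.
move=> pG; have [c _ /(_ _ pG)[F [d [F1 _ Fd _ _]]]] := pdmx_ldl n.
have d0 i := pdmx_ldl_gt0 i pG F1 Fd; have uF := det_sqr1_unit F1.
pose A' := F *m A *m F^T.
pose S := \sum_i \sum_j `|A' i j| * ((d 0 i)^-1 + (d 0 j)^-1).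
have S0 : 0 <= S.
  apply: sumr_ge0 => i _; apply: sumr_ge0 => j _; apply: mulr_ge0 => //.
  by rewrite addr_ge0// invr_ge0 ltW.
have S1 : 0 < 1 + S by rewrite ltr_pwDl.
exists (1 + S)^-1 => [|u]; first by rewrite invr_gt0.
have [v ->] : exists v, u = v *m F by exists (u *m invmx F); rewrite mulmxKV.
rewrite -!qf_congr -/A' Fd qf_diag.
set q := \sum_i _; rewrite mulrC ler_pdivrMr//.
have q0 : 0 <= q.
  by apply: sumr_ge0 => i _; rewrite mulr_ge0 ?sqr_ge0// ltW.
apply: (@le_trans _ _ (q * S)); last by rewrite ler_wpM2l// lerDr.
have vq i : v 0 i ^+ 2 <= q * (d 0 i)^-1.
  rewrite ler_pdivlMr// mulrC /q (bigD1 i)//= lerDl.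
  by apply: sumr_ge0 => j _; rewrite mulr_ge0 ?sqr_ge0// ltW.
rewrite qfE mulr_sumr; apply: ler_sum => i _; rewrite mulr_sumr.
apply: ler_sum => j _; apply: le_trans (ler_norm _) _.
rewrite normrM mulrCA [leLHS]mulrC ler_wpM2l// mulrDr.
apply: le_trans (lerD (vq i) (vq j)); rewrite ler_norml; apply/andP; split.
  have := sqr_ge0 (v 0 i + v 0 j); have := sqr_ge0 (v 0 i - v 0 j); nra.
have := sqr_ge0 (v 0 i + v 0 j); have := sqr_ge0 (v 0 i - v 0 j); nra.
Qed.

(** The dimension condition is applied to spans of basis vectors with the
    smallest values of the form, whence the increasing order. *)
Lemma pdmx_ldl_incr n : exists2 c : R, 0 <= c &
  forall G : 'M[R]_n, pdmx G -> exists F : 'M[R]_n, exists d : 'rV[R]_n,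
  [/\ \det F ^+ 2 = 1, forall i j, `|F i j| <= c, F *m G *m F^T = diag_mx d &
      forall i j : 'I_n, (i <= j)%N -> d 0 i <= d 0 j].
Proof.
have [c c0 ldl] := pdmx_ldl n; exists c => // G /ldl[F [d [F1 Fc FG dd _]]].
pose s := perm (@rev_ord_inj n).
exists (row_perm s F), (col_perm s d); split.
- by rewrite row_permE det_mulmx det_perm exprMn sqrr_sign mul1r.
- by move=> i j; rewrite mxE.
- rewrite row_permE trmx_mul !mulmxA tr_perm_mx.
  rewrite (_ : _ *m perm_mx s^-1 = col_perm s (row_perm s (F *m G *m F^T))); last first.
    by rewrite col_permE row_permE !mulmxA.
  rewrite FG; apply/matrixP => i j; rewrite !mxE; congr (_ *+ _).
  by rewrite (inj_eq perm_inj).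
- by move=> i j ij; rewrite !mxE dd// !permE /= leq_sub2l.
Qed.

End PosDefMatrix.

(** * Operators and their forms *)

Section FormMatrix.
Variable R : realType.
Implicit Types E F : euclidean R.

(** The matrix of the bilinear form (x, y) |-> <A x, y> in [vbasis]. *)
Definition formmx E (A : 'End(E)) : 'M[R]_(\dim {:E}) :=
  mxof (vbasis {:E}) (vbasis {:E}) A *m gram E.

Local Notation crd x := (rVof (vbasis fullv) x).

Lemma formmxP E (A : 'End(E)) (x y : E) :
  '[A x, y] = (crd x *m formmx A *m (crd y)^T) 0 0.
Proof. by rewrite dot_gram (rVof_app _ (vbasisP _)) mulmxA. Qed.

Lemma qf_formmx E (A : 'End(E)) (x : E) : qf (formmx A) (crd x) = '[A x, x].
Proof. by rewrite formmxP. Qed.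

Lemma formmx_selfadjoint E (A : 'End(E)) : selfadjoint A -> (formmx A)^T = formmx A.
Proof.
move=> sA; apply/matrixP => i j; rewrite mxE.
have E1 k l : formmx A k l = '[A (vbasis {:E})`_k, (vbasis {:E})`_l].
  rewrite formmxP !rVofE ?vbasisP//.
  by rewrite -rowE trmx_delta -colE !mxE.
by rewrite !E1 sA dotC.
Qed.

Lemma pdmx_formmx E (A : 'End(E)) : posdef A -> pdmx (formmx A).
Proof.
case=> sA pA; split=> [|u u0]; first exact: formmx_selfadjoint.
rewrite -[u](vecofK (vbasisP {:E})) qf_formmx pA//.
by rewrite vecof_eq0 ?vbasisP.
Qed.

Lemma posdef1 E : posdef (\1%VF : 'End(E)).
Proof. by split=> [x y|x x0]; rewrite !lfunE//= dot_gt0. Qed.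

(** [gram E] is the form of the identity. *)
Lemma det_gram_gt0 E : 0 < \det (gram E).
Proof.
have := pdmx_det_gt0 (pdmx_formmx (posdef1 E)).
by rewrite det_mulmx mxof1 ?det1 ?mul1r// (basis_free (vbasisP _)).
Qed.

Lemma det_formmx E (A : 'End(E)) : \det (formmx A) = detl A * \det (gram E).
Proof. exact: det_mulmx. Qed.

Lemma detl_gt0 E (A : 'End(E)) : posdef A -> 0 < detl A.
Proof.
move=> /pdmx_formmx/pdmx_det_gt0; rewrite det_formmx.
by rewrite pmulr_lgt0// det_gram_gt0.
Qed.

Lemma detlM E (A B : 'End(E)) : detl (A \o B)%VF = detl A * detl B.
Proof. by rewrite /detl (mxof_comp _ _ (vbasisP _)) det_mulmx mulrC. Qed.

Lemma posdef_dominates E (A B : 'End(E)) : posdef A ->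
  exists2 e : R, 0 < e & forall x, e * '[B x, x] <= '[A x, x].
Proof.
move=> /pdmx_formmx/(pdmx_dominates (formmx B))[e e0 h].
by exists e => // x; rewrite -!qf_formmx.
Qed.

End FormMatrix.

(** * Necessity of the dimension condition *)

Lemma card_ord_lt n k : (k <= n)%N -> #|[pred i : 'I_n | (i < k)%N]| = k.
Proof.
move=> kn; have widen_inj : injective (widen_ord kn).
  by move=> i j /(congr1 val)/= ij; apply/val_inj.
rewrite -[RHS]card_ord -(card_imset _ widen_inj).
apply: eq_card => i; apply/idP/imsetP => [ik|[j _ ->]]; last exact: (ltn_ord j).
by exists (Ordinal ik) => //; apply/val_inj.
Qed.

Section Operators.
Variable R : realType.
Implicit Types E F : euclidean R.

Lemma dotDl E (x y z : E) : '[x + y, z] = '[x, z] + '[y, z].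
Proof. by rewrite dotC dotDr !(dotC z). Qed.

Lemma dotZl E a (x y : E) : '[a *: x, y] = a * '[x, y].
Proof. by rewrite dotC dotZr dotC. Qed.

Lemma dotBl E (x y z : E) : '[x - y, z] = '[x, z] - '[y, z].
Proof. by rewrite dotC dotBr !(dotC z). Qed.

Lemma dot0l E (x : E) : '[0, x] = 0.
Proof. by rewrite dotC dot0r. Qed.

Lemma dot_ge0 E (x : E) : 0 <= '[x, x].
Proof. by have [->|/dot_gt0/ltW//] := eqVneq x 0; rewrite dot0r. Qed.

Lemma adjointPl E F (C : 'Hom(E, F)) (x : E) (y : F) :
  '[adjoint C y, x] = '[y, C x].
Proof. by rewrite dotC -adjointP dotC. Qed.

Lemma dot_inj E (x y : E) : (forall z, '[x, z] = '[y, z]) -> x = y.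
Proof.
move=> xy; apply/eqP; rewrite -subr_eq0; apply/negPn/negP => /dot_gt0.
by rewrite dotBl xy subrr ltxx.
Qed.

Lemma detl_eigenbasis E (e : (\dim {:E}).-tuple E) (a : 'I_(\dim {:E}) -> R)
    (A : 'End(E)) : basis_of {:E} e ->
  (forall i : 'I_(\dim {:E}), A e`_i = a i *: e`_i) -> detl A = \prod_i a i.
Proof.
move=> eB Ae; rewrite (detlE A eB).
suff -> : mxof e e A = diag_mx (\row_i a i).
  by rewrite det_diag; apply: eq_bigr => i _; rewrite mxE.
apply/row_matrixP => i; rewrite row_diag_mx rowE mul_mxof vecof_delta// Ae.
by rewrite linearZ/= rVofE// mxE.
Qed.

(** [projv U] projects along an unspecified complement of [U]. *)
Definition stretch E (U : {vspace E}) (t : R) : 'End(E) :=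
  t *: projv U + (\1%VF - projv U).

Lemma stretchE E (U : {vspace E}) t x :
  stretch U t x = t *: projv U x + (x - projv U x).
Proof. by rewrite !(add_lfunE, opp_lfunE, scale_lfunE, id_lfunE). Qed.

Lemma stretch_id E (U : {vspace E}) t x : x \in U -> stretch U t x = t *: x.
Proof. by move=> xU; rewrite stretchE projv_id// subrr addr0. Qed.

Lemma projv_compl E (U : {vspace E}) x : x \in (U^C)%VS -> projv U x = 0.
Proof. by rewrite -lker_proj memv_ker => /eqP. Qed.

Lemma projv_stretch E (U : {vspace E}) t x :
  projv U (stretch U t x) = t *: projv U x.
Proof. by rewrite stretchE linearD linearB linearZ/= !projv_proj subrr addr0. Qed.

Lemma stretch_proj E (U : {vspace E}) t x :
  stretch U t x - projv U (stretch U t x) = x - projv U x.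
Proof. by rewrite projv_stretch stretchE addrAC subrr add0r. Qed.

Lemma detl_stretch E (U : {vspace E}) t : detl (stretch U t) = t ^+ \dim U.
Proof.
pose X := vbasis U ++ vbasis (U^C)%VS.
have sX : size X == \dim {:E}.
  rewrite size_cat !size_tuple -(addv_complf U) dimv_disjoint_sum//.
  exact: capv_compl.
have XB : basis_of {:E} (Tuple sX).
  have dU : directv (U + U^C) by apply/directv_addP; apply: capv_compl.
  by have := cat_basis dU (vbasisP U) (vbasisP _); rewrite addv_complf.
rewrite (@detl_eigenbasis _ (Tuple sX) (fun i => if (i < \dim U)%N then t else 1))//.
  rewrite -big_mkcond/= prodr_const; congr (_ ^+ _).
  have dU : (\dim U <= \dim {:E})%N by rewrite dimvS// subvf.
  exact: card_ord_lt.
move=> i /=; rewrite nth_cat size_tuple; case: ifPn => iU.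
  by rewrite stretch_id// vbasis_mem// mem_nth// size_tuple.
have xU : (vbasis (U^C)%VS)`_(i - \dim U) \in (U^C)%VS.
  rewrite vbasis_mem// mem_nth// size_tuple dimv_compl ltn_sub2r//.
  by apply: leq_ltn_trans (ltn_ord i); rewrite leqNgt.
by rewrite stretchE projv_compl// scaler0 add0r subr0 scale1r.
Qed.

(** A positive definite operator for which [U] and the complement used by
    [stretch] are orthogonal, so that composing it with [stretch U t] gives a
    self-adjoint operator again. *)
Definition split_form E (U : {vspace E}) : 'End(E) :=
  (adjoint (projv U) \o projv U)%VF +
  (adjoint (\1 - projv U) \o (\1 - projv U))%VF.

Lemma dot_split_form E (U : {vspace E}) x y :
  '[split_form U x, y] =
    '[projv U x, projv U y] + '[x - projv U x, y - projv U y].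
Proof.
rewrite /split_form add_lfunE !comp_lfunE dotDl !adjointPl.
by rewrite !(add_lfunE, opp_lfunE, id_lfunE).
Qed.

Lemma dot_split_stretch E (U : {vspace E}) t x y :
  '[split_form U (stretch U t x), y] =
    t * '[projv U x, projv U y] + '[x - projv U x, y - projv U y].
Proof. by rewrite dot_split_form stretch_proj projv_stretch dotZl. Qed.

Lemma posdef_split_stretch E (U : {vspace E}) t d : 0 < t -> 0 < d ->
  posdef (d *: split_form U \o stretch U t)%VF.
Proof.
move=> t0 d0; have dE x y : '[(d *: split_form U \o stretch U t)%VF x, y] =
    d * (t * '[projv U x, projv U y] + '[x - projv U x, y - projv U y]).
  by rewrite comp_lfunE lfunE/= dotZl dot_split_stretch.
split=> [x y|x x0].
  by rewrite [RHS]dotC !dE; congr (_ * (_ * _ + _)); rewrite dotC.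
rewrite dE mulr_gt0//; have [p0|p0] := eqVneq (projv U x) 0.
  by rewrite p0 dot0r mulr0 add0r subr0 dot_gt0.
by rewrite ltr_pwDl ?dot_ge0// mulr_gt0// dot_gt0.
Qed.

Lemma split_stretch_le E (U : {vspace E}) (Q : 'End(E)) t d : posdef Q ->
  0 < t <= 1 -> 0 < d -> (forall x, d * '[split_form U x, x] <= '[Q x, x]) ->
  loewner_le (d *: split_form U \o stretch U t)%VF Q.
Proof.
move=> [sQ _] /andP[t0 t1] d0 dQ.
have [sB _] := posdef_split_stretch U t0 d0.
split=> [x y|x].
  by rewrite !add_lfunE !opp_lfunE dotBl dotBr sB sQ.
rewrite add_lfunE opp_lfunE dotBl subr_ge0; apply: le_trans (dQ x).
rewrite comp_lfunE lfunE/= dotZl ler_wpM2l ?(ltW d0)//.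
rewrite dot_split_stretch dot_split_form lerD2r.
by rewrite ler_piMl// dot_ge0.
Qed.

Lemma detl_scale_stretch E (U : {vspace E}) t A :
  detl (A \o stretch U t)%VF = detl A * t ^+ \dim U.
Proof. by rewrite detlM detl_stretch. Qed.

(** The Leibniz formula bounds this polynomial in [t] term by term. *)
Lemma detl_affine_bounded E (X Y : 'End(E)) :
  exists K, forall t, 0 <= t <= 1 -> detl (X + t *: Y) <= K.
Proof.
pose x := mxof (vbasis {:E}) (vbasis {:E}) X.
pose y := mxof (vbasis {:E}) (vbasis {:E}) Y.
exists (\sum_(s : 'S_(\dim {:E})) \prod_i (`|x i (s i)| + `|y i (s i)|)).
move=> t /andP[t0 t1]; apply: ler_sum => s _; apply: le_trans (ler_norm _) _.
rewrite normrM normrX normrN1 expr1n mul1r normr_prod.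
apply: ler_prod => i _; rewrite normr_ge0/= linearD linearZ/= mxE [X in _ + X]mxE -/x -/y.
by apply: le_trans (ler_normD _ _) _; rewrite normrM lerD2l ler_piMl// ger0_norm.
Qed.

End Operators.

Section Datum.
Variables (R : realType) (m : nat) (H : euclidean R) (Hs : 'I_m -> euclidean R).
Variables (C : forall i, 'Hom(H, Hs i)) (p : 'I_m -> R).
Variables (Q : forall i, 'End(Hs i)).
Hypothesis datum : gBL_datum C p Q.

(** The operator whose determinant is the denominator of [BL_ratio]. *)
Definition BLop (QH : 'End(H)) (B : forall i, 'End(Hs i)) : 'End(H) :=
  QH + \sum_i p i *: (adjoint (C i) \o (B i \o C i))%VF.

Lemma dot_BLop QH B x y :
  '[BLop QH B x, y] = '[QH x, y] + \sum_i p i * '[B i (C i x), C i y].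
Proof.
rewrite /BLop add_lfunE dotDl sum_lfunE dot_suml; congr (_ + _).
apply: eq_bigr => i _.
by rewrite scale_lfunE dotZl !comp_lfunE adjointPl.
Qed.

Lemma posdef_BLop QH B : psd QH -> (forall i, posdef (B i)) ->
  posdef (BLop QH B).
Proof.
move=> [sQ pQ] pB; have [Cs Ck p0 _] := datum; split=> [x y|x x0].
  rewrite [RHS]dotC !dot_BLop sQ dotC; congr (_ + _); apply: eq_bigr => i _.
  by have [sB _] := pB i; rewrite sB dotC.
rewrite dot_BLop ltr_wpDl//.
have t0 i : 0 <= p i * '[B i (C i x), C i x].
  apply: mulr_ge0; first exact: ltW.
  have [->|Cx] := eqVneq (C i x) 0; first by rewrite dot0r.
  by have [_ /(_ _ Cx)/ltW] := pB i.
rewrite lt_neqAle sumr_ge0// andbT eq_sym psumr_eq0//; apply/negP => /allP a0.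
move: x0; rewrite -memv0 -Ck memvE => /negP; apply; apply/subv_bigcapP => i _.
rewrite -memvE memv_ker; apply/negPn/negP => Cx.
have [_ /(_ _ Cx)] := pB i; have := a0 i (mem_index_enum i).
rewrite implyTb mulf_eq0 gt_eqF//= => /eqP ->; by rewrite ltxx.
Qed.

Lemma BL_bounded QH : (BL C p Q QH < +oo)%E <->
  exists K, forall B : (forall i, 'End(Hs i)),
    (forall i, posdef (B i) /\ loewner_le (B i) (Q i)) ->
    BL_ratio C p QH B <= K.
Proof.
split=> [fin|[K hK]].
  have [k hk] : exists k, forall B : (forall i, 'End(Hs i)),
      (forall i, posdef (B i) /\ loewner_le (B i) (Q i)) ->
      Num.sqrt (BL_ratio C p QH B) <= k.
    have ub : forall B : (forall i, 'End(Hs i)),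
        (forall i, posdef (B i) /\ loewner_le (B i) (Q i)) ->
        ((Num.sqrt (BL_ratio C p QH B))%:E <= BL C p Q QH)%E.
      by move=> B hB; apply: ereal_sup_ubound; exists B.
    move: fin ub; case: (BL C p Q QH) => [k| |]// _ ub.
      by exists k => B /ub; rewrite lee_fin.
    by exists 0 => B /ub; rewrite leeNy_eq.
  exists (k ^+ 2) => B /hk; have [r0|r0] := leP 0 (BL_ratio C p QH B).
    move=> rk; rewrite -(sqr_sqrtr r0) ler_pXn2r// ?nnegrE ?sqrtr_ge0//.
    by apply: le_trans rk; rewrite sqrtr_ge0.
  by move=> _; apply: le_trans (sqr_ge0 _); apply: ltW.
apply: (@le_lt_trans _ _ (Num.sqrt K)%:E); last exact: ltry.
apply: ge_ereal_sup => _ [B hB <-]; rewrite lee_fin; exact/ler_wsqrtr/hK.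
Qed.

(** Multiplying the forms by [t] along the [C j @: V] makes the numerator a
    constant times a power of [t], and the denominator [t ^+ \dim V] times a
    bounded factor; then let [t] tend to 0. *)
Lemma BL_finite_necessary QH (V : {vspace H}) : psd QH ->
  (BL C p Q QH < +oo)%E -> (V <= lker QH)%VS ->
  (\dim V)%:R <= \sum_(j < m) p j * (\dim (C j @: V)%VS)%:R.
Proof.
move=> pQ /BL_bounded[K hK] VQ; have [Cs Ck p0 pdQ] := datum.
pose U i := (C i @: V)%VS.
have /choice[d hd] : forall i, exists d : R, 0 < d /\
    forall x, d * '[split_form (U i) x, x] <= '[Q i x, x].
  by move=> i; have [d d0 hd] := posdef_dominates (split_form (U i)) (pdQ i); exists d.
pose B0 i := d i *: split_form (U i).
pose B t i := (B0 i \o stretch (U i) t)%VF.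
have hB t : 0 < t <= 1 -> forall i, posdef (B t i) /\ loewner_le (B t i) (Q i).
  move=> t01 i; have [t0 _] := andP t01; have [d0 dQ] := hd i; split.
    exact: posdef_split_stretch.
  exact: split_stretch_le.
pose c := \prod_i detl (B0 i) `^ p i.
have B00 i : 0 < detl (B0 i).
  have [d0 _] := hd i.
  have /detl_gt0 := posdef_split_stretch (U i) (@ltr01 R) d0.
  by rewrite detl_scale_stretch expr1n mulr1.
have c0 : 0 < c by apply: prodr_gt0 => i _; apply: powR_gt0.
pose s := \sum_i p i * (\dim (U i))%:R.
have detB x : \prod_i detl (B (expR x) i) `^ p i = c * expR (x * s).
  rewrite /c mulr_sumr expR_sum -big_split/=; apply: eq_bigr => i _.
  rewrite detl_scale_stretch powRM ?exprn_ge0 ?expR_ge0// ?(ltW (B00 i))//.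
  by congr (_ * _); rewrite -expRM_natr -expRM mulrA mulrAC.
(* [BLop QH (B t)] is [X + t *: Y] after [stretch V t]: on [V] it is [t] times
   [BLop 0 B0], because [stretch (U i) t] multiplies [C i @: V] by [t]. *)
pose X := (BLop 0 B0 \o projv V)%VF +
  (BLop QH (fun i => B0 i \o (\1 - projv (U i)))%VF \o (\1 - projv V))%VF.
pose Y := (BLop 0 (fun i => B0 i \o projv (U i))%VF \o (\1 - projv V))%VF.
have [L hL] := detl_affine_bounded X Y.
have detM t : detl (BLop QH (B t)) = detl (X + t *: Y) * t ^+ \dim V.
  rewrite -detl_scale_stretch; congr detl; apply/lfunP => x; apply: dot_inj => y.
  set b := x - projv V x; have xE : x = projv V x + b by rewrite addrC subrK.
  have QV : QH (projv V x) = 0.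
    by apply/eqP; rewrite -memv_ker (subvP VQ)// memv_proj.
  have cE E (W : {vspace E}) z : (\1 - projv W)%VF z = z - projv W z.
    by rewrite add_lfunE opp_lfunE id_lfunE.
  have -> : ((X + t *: Y) \o stretch V t)%VF x =
      BLop 0 B0 (t *: projv V x) +
      BLop QH (fun i => B0 i \o (\1 - projv (U i)))%VF b +
      t *: BLop 0 (fun i => B0 i \o projv (U i))%VF b.
    rewrite comp_lfunE [LHS]add_lfunE scale_lfunE /X /Y.
    rewrite [X in X + _]add_lfunE 3![(_ \o _)%VF (stretch V t x)]comp_lfunE !cE.
    by rewrite stretch_proj projv_stretch.
  rewrite linearZ/= !(dotDl, dotZl) !dot_BLop.
  rewrite !zero_lfunE dot0l !add0r {1}xE linearD/= QV add0r.
  rewrite addrCA -addrA; congr (_ + _).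
  rewrite !mulr_sumr -!big_split/=; apply: eq_bigr => i _.
  rewrite /B !comp_lfunE cE.
  have -> : stretch (U i) t (C i x) = t *: C i (projv V x) +
      (C i b - projv (U i) (C i b)) + t *: projv (U i) (C i b).
    rewrite [in LHS]xE linearD/= [LHS]linearD/= stretch_id ?memv_img ?memv_proj//.
    by rewrite stretchE -addrA; congr (_ + _); rewrite addrC.
  by rewrite !linearD !linearZ/= !dotDl !dotZl; ring.
have bound x : x <= 0 -> c * expR (x * s) <= K * L * expR (x * (\dim V)%:R).
  move=> x0; have t01 : 0 < expR x <= 1 by rewrite expR_gt0 expR_le1.
  have d0 : 0 < detl (BLop QH (B (expR x))).
    by apply/detl_gt0/posdef_BLop => // i; have [] := hB _ t01 i.
  have := hK _ (hB _ t01); rewrite /BL_ratio detB -/(BLop QH _) => h.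
  have K0 : 0 <= K.
    by apply: le_trans h; rewrite divr_ge0 ?(ltW d0)// mulr_ge0 ?(ltW c0)// expR_ge0.
  move: h; rewrite ler_pdivrMr// => /le_trans; apply.
  rewrite detM mulrA expRM_natr; apply: ler_wpM2r; first by rewrite exprn_ge0// expR_ge0.
  by rewrite ler_wpM2l// hL// expR_ge0 expR_le1.
rewrite -/s leNgt; apply/negP => sV.
have KL0 : 0 <= K * L.
  have := bound 0 (lexx _); rewrite !mul0r expR0 !mulr1; apply: le_trans; exact: ltW.
pose v : R := (\dim V)%:R; have vs : 0 < v - s by rewrite subr_gt0.
(* With this exponent, [1 + x <= expR x] already contradicts the bound. *)
pose t := K * L / (c * (v - s)).
have t0 : 0 <= t by rewrite divr_ge0// mulr_ge0 ?(ltW c0)// ltW.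
have := bound (- t); rewrite oppr_le0 => /(_ t0); rewrite -/v.
have -> : - t * s = t * (v - s) + - t * v by ring.
rewrite expRD mulrA ler_pM2r ?expR_gt0// => h.
have := expR_ge1Dx (t * (v - s)).
rewrite -(ler_pM2l c0) => /le_trans/(_ h).
have -> : c * (1 + t * (v - s)) = c + K * L.
  by rewrite /t; field; rewrite !gt_eqF.
by rewrite gerDr leNgt c0.
Qed.

End Datum.

(** * Greedy bases and summation by parts *)

Section Greedy.
Variables (K : fieldType) (vT : vectType K).

Lemma dimv_add_line (U : {vspace vT}) v :
  \dim (U + <[v]>)%VS = (\dim U + (v \notin U))%N.
Proof.
case: (boolP (v \in U)) => vU.
  by rewrite addn0; congr (\dim _); apply/addv_idPl; rewrite -memvE.
have v0 : v != 0 by apply: contraNneq vU => ->; apply: mem0v.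
rewrite dimv_disjoint_sum ?dim_vline ?v0//.
apply/eqP; rewrite -subv0; apply/subvP => x /memv_capP[xU /vlineP[a xa]].
rewrite memv0 xa scaler_eq0; apply/orP; left.
apply: contraNT vU => a0; by rewrite -[v]scale1r -(mulVf a0) -scalerA -xa memvZ.
Qed.

Variables (n : nat) (X : 'I_n -> vT).

Definition prefix_span k := (\sum_(j < n | (j < k)%N) <[X j]>)%VS.

(** Scanning the vectors from the left and keeping those outside the span of
    the previous ones: the kept vectors of each prefix form a basis of the span
    of that prefix. *)
Definition greedy : {set 'I_n} := [set k | X k \notin prefix_span k].

Lemma prefix_spanS (k : 'I_n) :
  prefix_span k.+1 = (prefix_span k + <[X k]>)%VS.
Proof.
rewrite /prefix_span (bigD1 k)//= addvC; congr (_ + _)%VS.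
by apply: eq_bigl => j; rewrite ltnS andbC ltn_neqAle.
Qed.

Lemma prefix_span_greedy k : (k <= n)%N ->
  prefix_span k = (\sum_(j in greedy | (j < k)%N) <[X j]>)%VS.
Proof.
elim: k => [_|k IH kn].
  by rewrite /prefix_span !big_pred0// => j; rewrite ltn0 ?andbF.
pose i := Ordinal kn; rewrite -[k]/(val i) prefix_spanS /= IH 1?ltnW//.
case: (boolP (i \in greedy)) => iI.
  rewrite [RHS](bigD1 i)/= ?iI ?leqnn// addvC; congr (_ + _)%VS.
  by apply: eq_bigl => j; rewrite ltnS -andbA [(j <= k)%N && _]andbC -ltn_neqAle.
rewrite -IH 1?ltnW//; move: (iI); rewrite inE negbK memvE => /addv_idPl ->.
rewrite IH 1?ltnW//; apply: eq_bigl => j; rewrite ltnS [in RHS]leq_eqVlt.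
by case: eqP => // jk; have -> : j = i; [apply/val_inj|rewrite (negPf iI)].
Qed.

Lemma dim_prefix_span k : (k <= n)%N ->
  \dim (prefix_span k) = #|[set j in greedy | (j < k)%N]|.
Proof.
elim: k => [_|k IH kn].
  rewrite /prefix_span big_pred0 ?dimv0; last by move=> j; rewrite ltn0.
  by apply/esym/eqP; rewrite cards_eq0; apply/eqP/setP => j; rewrite !inE andbF.
pose i := Ordinal kn; rewrite -[k]/(val i) prefix_spanS /= dimv_add_line.
rewrite IH 1?ltnW// (cardsD1 i [set j in greedy | (j < k.+1)%N]) addnC.
congr (_ + _)%N; first by rewrite !inE ltnSn andbT.
apply: eq_card => j; rewrite !inE ltnS andbCA; congr (_ && _).
by rewrite ltn_neqAle.
Qed.

End Greedy.

Lemma greedy_basis (R : realType) (E : euclidean R) n (X : 'I_n -> E) :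
  prefix_span X n = fullv -> exists f : 'I_(\dim {:E}) -> 'I_n,
    (\matrix_a rVof (vbasis {:E}) (X (f a)) \in unitmx) /\
    forall d : 'I_n -> R, \prod_a d (f a) = \prod_(k in greedy X) d k.
Proof.
move=> Xfull; pose I := greedy X.
have II k : (k \in I) && (k < n)%N = (k \in I) by rewrite ltn_ord andbT.
have cI : \dim {:E} = #|I|.
  by rewrite -Xfull dim_prefix_span//; apply: eq_card => k; rewrite inE II.
pose f a : 'I_n := enum_val (cast_ord cI a); exists f; split.
  pose e := [tuple X (f a) | a < \dim {:E}].
  have eB : basis_of {:E} e.
    rewrite basisEdim size_tuple leqnn andbT.
    have sub : (prefix_span X n <= <<e>>)%VS; last by rewrite Xfull in sub.
    rewrite prefix_span_greedy//; under eq_bigl => k do rewrite II.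
    apply/subv_sumP => k kI; rewrite -memvE memv_span//.
    apply/codomP; exists (cast_ord (esym cI) (enum_rank_in kI k)).
    by rewrite /f cast_ordKV enum_rankK_in.
  rewrite (_ : \matrix_a _ = mxof e (vbasis {:E}) \1%VF).
    have : mxof e (vbasis {:E}) \1 *m mxof (vbasis {:E}) e \1 = 1%:M.
      by rewrite -mxof_comp ?vbasisP// comp_lfun1l mxof1// (basis_free eB).
    by move/mulmx1_unit => [].
  apply/row_matrixP => a; rewrite rowK rowE mul_mxof vecof_delta// id_lfunE.
  by rewrite -tnth_nth tnth_mktuple.
move=> d; rewrite -/I [RHS]big_enum_val [RHS](reindex (cast_ord cI)) //=;
  apply/onW_bij/(Bijective (cast_ordK cI) (cast_ordKV cI)).
Qed.

Section Abel.
Variable R : realFieldType.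

(** Summation by parts, in inductive form: the last [x] bounds all the others. *)
Lemma sum_monotone_le n (b x : 'I_n -> R) y :
  (forall k, (k <= n)%N -> 0 <= \sum_(j < n | (j < k)%N) b j) ->
  (forall i j : 'I_n, (i <= j)%N -> x i <= x j) -> (forall i, x i <= y) ->
  \sum_i b i * x i <= (\sum_i b i) * y.
Proof.
elim: n b x y => [|n IH] b x y b0 xx xy; first by rewrite !big_ord0 mul0r.
rewrite big_ord_recr/=; set B := \sum_(i < n) _.
have pre k : (k <= n)%N -> \sum_(j < n.+1 | (j < k)%N) b j =
    \sum_(j < n | (j < k)%N) b (widen_ord (leqnSn n) j).
  move=> kn; rewrite big_mkcond big_ord_recr/= ltnNge kn addr0.
  by rewrite -big_mkcond.
have {}IH : B <= (\sum_(i < n) b (widen_ord (leqnSn n) i)) * x ord_max.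
  apply: IH => [k kn|i j ij|i]; [|exact: xx|].
    by rewrite -pre// b0// leqW.
  by apply: xx; rewrite /= ltnW.
apply: (@le_trans _ _ ((\sum_i b i) * x ord_max)).
  by rewrite big_ord_recr/= mulrDl lerD2r.
rewrite ler_wpM2l//; have := b0 n.+1 (leqnn _).
by under eq_bigl => j do rewrite ltn_ord.
Qed.

(** Indices below [r] are controlled by the prefix sums, the others because
    there the variables stay in a bounded interval. *)
Lemma prefix_sum_bound n (a : 'I_n -> R) (r : nat) (c L : R) :
  (forall k, (k <= r)%N -> (k <= n)%N -> k%:R <= \sum_(j < n | (j < k)%N) a j) ->
  exists K, forall x : 'I_n -> R,
    (forall i j : 'I_n, (i <= j)%N -> x i <= x j) -> (forall i, x i <= L) ->
    (forall i : 'I_n, (r <= i)%N -> c <= x i) ->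
    \sum_i (a i - 1) * x i <= K.
Proof.
move=> ar; pose b (i : 'I_n) := if (i < r)%N then a i - 1 else 0.
exists ((\sum_i b i) * L + \sum_i `|a i - 1| * (`|c| + `|L|)) => x xx xL xc.
apply: (@le_trans _ _ (\sum_i b i * x i + \sum_i (a i - 1 - b i) * x i)).
  by rewrite -big_split/=; apply: ler_sum => i _; rewrite -mulrDl [b i + _]addrC subrK.
apply: lerD.
  apply: sum_monotone_le => // k kn.
  rewrite /b -big_mkcondr/=.
  rewrite (eq_bigl (fun j : 'I_n => (j < minn k r)%N)); last first.
    by move=> j; rewrite leq_min.
  rewrite sumrB subr_ge0 sumr_const.
  apply: le_trans (ar (minn k r) (geq_minr _ _) _); last first.
    by rewrite geq_min kn.
  have kr : (minn k r <= n)%N by rewrite geq_min kn.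
  by rewrite ler_nat (card_ord_lt kr).
apply: ler_sum => i _; rewrite /b; case: ltnP => ri.
  by rewrite subrr mul0r mulr_ge0// addr_ge0.
rewrite subr0; apply: le_trans (ler_norm _) _; rewrite normrM ler_wpM2l//.
have := xc _ ri; have := xL i.
have := ler_norm L; have := ler_norm (- c); have := normr_ge0 L.
have := normr_ge0 c; rewrite normrN ler_norml; lra.
Qed.

End Abel.

(** * Compactness of the set of bases *)

Section Continuity.
Variables (R : realType) (T : topologicalType).

Lemma continuous_sumr (I : Type) (r : seq I) (F : I -> T -> R) :
  (forall i, continuous (F i)) -> continuous (fun t => \sum_(i <- r) F i t).
Proof. by move=> cF; apply: continuous_big => //; apply: add_continuous. Qed.

Lemma continuous_prodr (I : Type) (r : seq I) (F : I -> T -> R) :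
  (forall i, continuous (F i)) -> continuous (fun t => \prod_(i <- r) F i t).
Proof. by move=> cF; apply: continuous_big => //; apply: mul_continuous. Qed.

Lemma continuous_mulr (f g : T -> R) :
  continuous f -> continuous g -> continuous (fun t => f t * g t).
Proof. by move=> cf cg t; apply: cvgM; [apply: cf|apply: cg]. Qed.

Lemma continuous_det n (A : T -> 'M[R]_n) :
  (forall i j, continuous (fun t => A t i j)) -> continuous (fun t => \det (A t)).
Proof.
move=> cA; apply: continuous_sumr => s; apply: continuous_mulr.
  exact: cst_continuous.
exact: continuous_prodr.
Qed.

Lemma continuous_qf_row n (A : T -> 'M[R]_n) (G : 'M[R]_n) k :
  (forall i j, continuous (fun t => A t i j)) ->
  continuous (fun t => qf G (row k (A t))).
Proof.
move=> cA; under eq_fun do rewrite qfE.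
do 2![apply: continuous_sumr => ?].
apply: continuous_mulr; last exact: cst_continuous.
by apply: continuous_mulr; under eq_fun do rewrite mxE; apply: cA.
Qed.

End Continuity.

Lemma continuous_vec_mx (R : realType) m n i j :
  continuous (fun w : 'rV[R]_(m * n) => vec_mx w i j).
Proof.
rewrite (_ : (fun _ => _) = (fun w : 'rV[R]_(m * n) => w 0 (mxvec_index i j))).
  exact: coord_continuous.
by apply/funext => w; rewrite mxE.
Qed.

(** Prescribing the determinant up to sign keeps limits of bases inside the set
    of bases. *)
Lemma compact_bounded_det1 (R : realType) n (c : R) :
  compact [set w : 'rV[R]_(n * n) | (forall i, `|w 0 i| <= c) /\
                                    \det (vec_mx w) ^+ 2 = 1].
Proof.
apply: (@compact_closedI _ [set w : 'rV[R]_(n * n) | forall i, `|w 0 i| <= c]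
   [set w | \det (vec_mx w) ^+ 2 = 1]).
  have -> : [set w : 'rV[R]_(n * n) | forall i, `|w 0 i| <= c] =
      [set w | forall i, `[- c, c]%classic (w ord0 i)].
    by apply/seteqP; split=> w /= wc i; have := wc i;
      rewrite in_itv/= ler_norml.
  apply: (@rV_compact R _ (fun=> `[- c, c]%classic)) => i.
  exact: segment_compact.
have cf : continuous (fun w : 'rV[R]_(n * n) => \det (vec_mx w) ^+ 2).
  under eq_fun do rewrite expr2.
  by apply: continuous_mulr; apply: continuous_det => i j;
    apply: continuous_vec_mx.
have /continuous_closedP/(_ [set x | x = 1]) := cf; apply; exact: closed_eq.
Qed.

Section Vecs.
Variables (R : realType) (H : euclidean R).
Local Notation N := (\dim {:H}).
Implicit Types (F : 'M[R]_N) (A : 'End(H)).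

Definition vecs F (k : 'I_N) : H := vecof (vbasis {:H}) (row k F).

Lemma dot_vecs A F k : '[A (vecs F k), vecs F k] = qf (formmx A) (row k F).
Proof. by rewrite -qf_formmx vecofK ?vbasisP. Qed.

Lemma dot_vecs_diag A F (d : 'rV[R]_N) k :
  F *m formmx A *m F^T = diag_mx d -> '[A (vecs F k), vecs F k] = d 0 k.
Proof.
by move=> FA; rewrite dot_vecs rowE -qf_congr FA qf_delta mxE eqxx.
Qed.

Lemma prefix_span_vecs F : F \in unitmx -> prefix_span (vecs F) N = fullv.
Proof.
move=> uF; apply/eqP; rewrite eqEsubv subvf/=; apply/subvP => x _.
rewrite -(rVofK (vbasisP {:H}) x) -(mulmxKV uF (rVof _ x)) mulmx_sum_row.
rewrite linear_sum/=; under eq_bigr do rewrite linearZ/=.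
apply: rpred_sum => k _; apply: rpredZ.
by rewrite -/(vecs F k) memvE (sumv_sup k).
Qed.

Lemma dim_prefix_span_vecs F k : F \in unitmx -> (k <= N)%N ->
  \dim (prefix_span (vecs F) k) = k.
Proof.
move=> uF kN; rewrite dim_prefix_span//.
have cN : #|greedy (vecs F)| = N.
  rewrite -[RHS](congr1 (fun U => \dim U) (prefix_span_vecs uF)).
  by rewrite dim_prefix_span//; apply: eq_card => i; rewrite inE ltn_ord andbT.
have gT : greedy (vecs F) =i predT.
  by apply/subset_cardP; rewrite ?cN ?card_ord//; apply/fintype.subsetP.
by rewrite -[RHS](card_ord_lt kN); apply: eq_card => i; rewrite inE gT.
Qed.

End Vecs.

Lemma limg_prefix_span (K : fieldType) (U V : vectType K) (f : 'Hom(U, V)) n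
    (X : 'I_n -> U) k :
  (f @: prefix_span X k)%VS = prefix_span (fun j => f (X j)) k.
Proof. by rewrite limg_sum; apply: eq_bigr => j _; rewrite limg_line. Qed.

(** [det_le_prod_diag] for the matrix of the form of [B] in the basis [g]. *)
Lemma detl_le_prod (R : realType) (E : euclidean R) (B : 'End(E))
    (g : 'I_(\dim {:E}) -> E) (W := \matrix_a rVof (vbasis {:E}) (g a)) :
  posdef B -> W \in unitmx ->
  detl B * (\det W ^+ 2 * \det (gram E)) <=
    (\dim {:E})`!%:R * \prod_a '[B (g a), g a].
Proof.
move=> pB uW; have := det_le_prod_diag (pdmx_congr uW (pdmx_formmx pB)).
rewrite 2!det_mulmx det_tr det_formmx.
congr (_ <= _ * _); first by ring.
by apply: eq_bigr => a _; rewrite -qf_delta qf_congr -rowE rowK qf_formmx.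
Qed.

(** * Sufficiency of the dimension condition *)

(** Otherwise the form would be negative at [x - e *: A x] for small [e]. *)
Lemma psd_ker (R : realType) (E : euclidean R) (A : 'End(E)) x :
  psd A -> '[A x, x] = 0 -> A x = 0.
Proof.
move=> [sA pA] Ax0; apply/eqP/negPn/negP => /dot_gt0.
set s := '[_, _] => s0; pose q := '[A (A x), A x].
have q0 : 0 <= q := pA _; have q1 : 0 < q + 1 by rewrite ltr_wpDl.
pose e := s / (q + 1); have e0 : 0 < e by rewrite divr_gt0.
have := pA (x - e *: A x).
rewrite linearB linearZ/= dotBl !dotBr !dotZl !dotZr Ax0.
rewrite -/s sA -/s -/q.
have eq : e * q < s.
  by rewrite /e mulrAC ltr_pdivrMr// ltr_pM2l// ltrDl.
nra.
Qed.

Lemma prod_powR_le (R : realType) m n (I : 'I_m -> {set 'I_n})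
    (p b kap : 'I_m -> R) (d : 'I_n -> R) :
  (forall i, 0 <= p i) -> (forall i, 0 <= kap i) -> (forall k, 0 < d k) ->
  (forall i, 0 <= b i) -> (forall i, b i <= kap i * \prod_(k in I i) d k) ->
  \prod_i b i `^ p i <= (\prod_i kap i `^ p i) *
    expR (\sum_k (\sum_i p i * (k \in I i)%:R) * ln (d k)).
Proof.
move=> p0 kap0 d0 b0 bd.
under [X in expR X]eq_bigr do rewrite mulr_suml.
rewrite exchange_big/= expR_sum -big_split/=; apply: ler_prod => i _.
rewrite powR_ge0/=.
have -> : \sum_k p i * (k \in I i)%:R * ln (d k) =
    (\sum_(k in I i) ln (d k)) * p i.
  rewrite mulr_suml [RHS]big_mkcond/=; apply: eq_bigr => k _.
  by case: (k \in I i); rewrite ?mulr1 ?mulr0 ?mul0r// mulrC.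
rewrite expRM expR_sum.
have -> : \prod_(k in I i) expR (ln (d k)) = \prod_(k in I i) d k.
  by apply: eq_bigr => k _; rewrite lnK ?posrE.
have dI0 : 0 <= \prod_(k in I i) d k by apply: prodr_ge0 => k _; apply: ltW.
by rewrite -powRM// ge0_ler_powR ?nnegrE// mulr_ge0.
Qed.

Section Sufficiency.
Variables (R : realType) (m : nat) (H : euclidean R) (Hs : 'I_m -> euclidean R).
Variables (C : forall i, 'Hom(H, Hs i)) (p : 'I_m -> R).
Variables (Q : forall i, 'End(Hs i)) (QH : 'End(H)).
Hypotheses (datum : gBL_datum C p Q) (psdQH : psd QH).
Hypothesis dim_cond : forall V : {vspace H}, (V <= lker QH)%VS ->
  (\dim V)%:R <= \sum_(j < m) p j * (\dim (C j @: V)%VS)%:R.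

Local Notation N := (\dim {:H}).
Local Notation M B := (BLop C p QH B).
Local Notation "w .-vec" := (vecs (vec_mx w)) (at level 2).

Definition admissible (B : forall i, 'End(Hs i)) : Prop :=
  forall i, posdef (B i) /\ loewner_le (B i) (Q i).

(** Every admissible [B] is diagonalized by some [w]; restricting to the [B] that
    a given [w] diagonalizes makes the bound local in [w]. *)
Definition ratio_bound (K : R) (w : 'rV[R]_(N * N)) : Prop :=
  forall B, admissible B -> forall d : 'rV[R]_N,
    vec_mx w *m formmx (M B) *m (vec_mx w)^T = diag_mx d ->
    (forall i j : 'I_N, (i <= j)%N -> d 0 i <= d 0 j) ->
    BL_ratio C p QH B <= K.

Lemma continuous_dot_vecs (A : 'End(H)) k :
  continuous (fun w : 'rV[R]_(N * N) => '[A (w.-vec k), w.-vec k]).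
Proof.
under eq_fun do rewrite dot_vecs.
by apply: continuous_qf_row => i j; apply: continuous_vec_mx.
Qed.

Lemma dot_BLop_ge_form B x : (forall i, posdef (B i)) ->
  '[QH x, x] <= '[M B x, x].
Proof.
have [_ _ p0 _] := datum => pB.
rewrite dot_BLop lerDl sumr_ge0// => i _; rewrite mulr_ge0 ?(ltW (p0 i))//.
have [->|Cx] := eqVneq (C i x) 0; first by rewrite dot0r.
by have [_ /(_ _ Cx)/ltW] := pB i.
Qed.

Lemma dot_BLop_ge_term B x i : (forall i, posdef (B i)) ->
  p i * '[B i (C i x), C i x] <= '[M B x, x].
Proof.
have [_ _ p0 _] := datum => pB; have [_ Qx] := psdQH.
rewrite dot_BLop (bigD1 i)//= addrCA lerDl addr_ge0// sumr_ge0// => j _.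
rewrite mulr_ge0 ?(ltW (p0 j))//.
have [->|Cx] := eqVneq (C j x) 0; first by rewrite dot0r.
by have [_ /(_ _ Cx)/ltW] := pB j.
Qed.

Lemma dot_BLop_le B x : admissible B -> '[M B x, x] <= '[M Q x, x].
Proof.
have [_ _ p0 _] := datum => aB; rewrite !dot_BLop lerD2l; apply: ler_sum => i _.
rewrite ler_pM2l// -subr_ge0 -dotBl; have [_ [_ /(_ (C i x))]] := aB i.
by rewrite add_lfunE opp_lfunE.
Qed.

(** [r] is the index of the first vector outside the kernel, or [N] if there is
    none, in which case the second clause is void. *)
Lemma near_kernel_prefix (w0 : 'rV[R]_(N * N)) : exists r : nat,
  (forall j : 'I_N, (j < r)%N -> w0.-vec j \in lker QH) /\
  exists2 c : R, 0 < c & \forall w \near w0, forall j : 'I_N, (r = j)%N ->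
    c < '[QH (w.-vec j), w.-vec j].
Proof.
have [sQ pQ] := psdQH.
case: (pickP (fun j : 'I_N => w0.-vec j \notin lker QH)) => [j0 hj0|none].
  case: (@arg_minnP _ j0 (fun j : 'I_N => w0.-vec j \notin lker QH) (@nat_of_ord _) hj0)
    => {hj0}j0 hj0 jmin.
  exists j0; split.
    by move=> j; apply: contraTT => hj; rewrite -leqNgt jmin.
  have pos : 0 < '[QH (w0.-vec j0), w0.-vec j0].
    rewrite lt_neqAle pQ andbT eq_sym; apply: contra hj0 => /eqP q0.
    by rewrite memv_ker (psd_ker psdQH q0).
  exists ('[QH (w0.-vec j0), w0.-vec j0] / 2); first by rewrite divr_gt0.
  have cv := cvgr_gt _ (@continuous_dot_vecs QH j0 w0).
  have [_ /cv near_gt] := midf_lt pos.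
  apply: filterS near_gt => w; rewrite add0r => lt_w j j0j.
  by have <- : j0 = j by apply/val_inj.
exists N; split=> [j _|]; first by have /negbFE := none j.
by exists 1 => //; near=> w => j Nj; have := ltn_ord j; rewrite -Nj ltnn.
Unshelve. all: end_near.
Qed.

(** Near [w0] the index sets chosen greedily for [w0] still give bases of the
    [Hs i], with determinants bounded away from 0; the choice itself may not be
    the greedy one for [w], which is why the bound is first a local one. *)
Lemma local_bound (w0 : 'rV[R]_(N * N)) : \det (vec_mx w0) ^+ 2 = 1 ->
  exists K, \forall w \near w0, \det (vec_mx w) ^+ 2 = 1 -> ratio_bound K w.
Proof.
move=> w1; have uF := det_sqr1_unit w1; have [Cs _ p0 _] := datum.
pose X i (w : 'rV[R]_(N * N)) k := C i (w.-vec k).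
have Xfull i : prefix_span (X i w0) N = fullv.
  by rewrite -limg_prefix_span prefix_span_vecs.
pose f i := sval (cid (greedy_basis (Xfull i))).
have hf i := svalP (cid (greedy_basis (Xfull i))).
pose W i w := \matrix_a rVof (vbasis {:Hs i}) (X i w (f i a)).
pose I i := greedy (X i w0).
(* Lower bound, valid near [w0], for the squared determinant of [W i]. *)
pose del i := \det (W i w0) ^+ 2 / 2.
have del0 i : 0 < del i.
  have [uW _] := hf i; rewrite divr_gt0// lt_neqAle sqr_ge0 andbT eq_sym sqrf_eq0.
  by rewrite -unitfE -unitmxE.
have near_det : \forall w \near w0, forall i, del i < \det (W i w) ^+ 2.
  suff near_i : forall i, \forall w \near w0, del i < \det (W i w) ^+ 2.
    exact: filter_forall near_i.
  move=> i.
  have cW : continuous (fun w => \det (W i w) ^+ 2).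
    under eq_fun do rewrite expr2.
    suff cd : continuous (fun w => \det (W i w)) by apply: continuous_mulr.
    apply: continuous_det => a b.
    rewrite (_ : (fun _ => _) = (fun w : 'rV[R]_(N * N) => \sum_l
      vec_mx w (f i a) l * mxof (vbasis {:H}) (vbasis {:Hs i}) (C i) l b)).
      apply: continuous_sumr => l; apply: continuous_mulr.
        exact: continuous_vec_mx.
      exact: cst_continuous.
    apply/funext => w; rewrite mxE (rVof_app _ (vbasisP _)) vecofK ?vbasisP// mxE.
    by apply: eq_bigr => l _; rewrite mxE.
  apply: (cvgr_gt _ (cW w0)); rewrite /del.
  have := del0 i; rewrite /del; lra.
(* Upper bound, valid near [w0], for all the values [d 0 k]. *)
pose L := 1 + \sum_k '[M Q (w0.-vec k), w0.-vec k].
have MQ0 x : 0 <= '[M Q x, x].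
  have [_ _ _ pQ] := datum; have [_ Qp] := psdQH.
  by apply: le_trans (dot_BLop_ge_form _ pQ).
have near_le : \forall w \near w0, forall k,
    '[M Q (w.-vec k), w.-vec k] < L.
  suff near_k : forall k, \forall w \near w0, '[M Q (w.-vec k), w.-vec k] < L.
    exact: filter_forall near_k.
  move=> k.
  apply: (cvgr_lt _ (@continuous_dot_vecs (M Q) k w0)).
  by rewrite /L (bigD1 k)//= addrCA ltrDl ltr_pwDl// sumr_ge0.
have [r [rker [c c0 near_r]]] := near_kernel_prefix w0.
pose a k := \sum_i p i * (k \in I i)%:R.
have a_pre k : (k <= r)%N -> (k <= N)%N -> k%:R <= \sum_(j < N | (j < k)%N) a j.
  move=> kr kN; rewrite -[X in X%:R](dim_prefix_span_vecs uF kN).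
  apply: le_trans (dim_cond _) _.
    apply/subv_sumP => j jk; rewrite -memvE rker//.
    exact: leq_trans kr.
  rewrite /a exchange_big/=; apply: ler_sum => i _.
  rewrite -mulr_sumr ler_wpM2l ?(ltW (p0 i))//.
  rewrite limg_prefix_span -/(X i w0) dim_prefix_span// -natr_sum ler_nat.
  rewrite -sum1_card big_mkcond [leqRHS]big_mkcond/=; apply: leq_sum => j _.
  by rewrite !inE; case: (j < k)%N; rewrite ?andbT ?andbF//; case: (_ \in _).
have [K1 hK1] := prefix_sum_bound (ln c) (ln L) a_pre.
pose n i := \dim {:Hs i}.
(* The constant in [detl (B i) <= kap i * \prod_(k in I i) d 0 k]. *)
pose kap i := (n i)`!%:R * (p i)^-1 ^+ n i / (del i * \det (gram (Hs i))).
have kap0 i : 0 <= kap i.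
  rewrite divr_ge0// mulr_ge0 ?exprn_ge0 ?invr_ge0 ?(ltW (p0 i)) ?(ltW (del0 i))//.
  exact/ltW/det_gram_gt0.
exists ((\prod_i kap i `^ p i) * \det (gram H) * expR K1).
near=> w => w2 B aB d FB dd.
have wdet : forall i, del i < \det (W i w) ^+ 2 by near: w.
have wL : forall k, '[M Q (w.-vec k), w.-vec k] < L by near: w.
have wr : forall j : 'I_N, r = j -> c < '[QH (w.-vec j), w.-vec j] by near: w.
have pB i : posdef (B i) by have [] := aB i.
have pM : posdef (M B) by apply: (posdef_BLop datum).
have d0 k : 0 < d 0 k by apply: (pdmx_ldl_gt0 k (pdmx_formmx pM) w2 FB).
have dE k : '[M B (w.-vec k), w.-vec k] = d 0 k by apply: dot_vecs_diag.
have ltL k : d 0 k < L.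
  rewrite -dE; exact: le_lt_trans (dot_BLop_le _ aB) _.
have gtc (k : 'I_N) : (r <= k)%N -> c <= d 0 k.
  move=> rk; have rN : (r < N)%N by apply: leq_ltn_trans (ltn_ord k).
  apply: le_trans (dd (Ordinal rN) k rk).
  rewrite -dE; apply: le_trans (dot_BLop_ge_form _ pB).
  exact/ltW/wr.
have xK1 : \sum_k (a k - 1) * ln (d 0 k) <= K1.
  apply: (hK1 (fun k => ln (d 0 k))) => /= [i j ij|i|i ri].
  - by rewrite ler_ln ?posrE// dd.
  - by rewrite ler_ln ?posrE// ?ltW//; apply: lt_trans (ltL i).
  - by rewrite ler_ln ?posrE// gtc.
have detB i : detl (B i) <= kap i * \prod_(k in I i) d 0 k.
  have uW : W i w \in unitmx.
    rewrite unitmxE unitfE -sqrf_eq0 gt_eqF//; exact: lt_trans (wdet i).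
  have g0 := det_gram_gt0 (Hs i).
  rewrite /kap mulrAC ler_pdivlMr ?(mulr_gt0 (del0 i) g0)//.
  apply: (@le_trans _ _ (detl (B i) * (\det (W i w) ^+ 2 * \det (gram (Hs i))))).
    by rewrite ler_pM2l ?detl_gt0// ler_pM2r// ltW.
  apply: le_trans (detl_le_prod (pB i) uW) _.
  rewrite -mulrA ler_wpM2l//; have [_ <-] := hf i.
  rewrite -[X in _ ^+ X]card_ord -prodr_const -big_split/=.
  apply: ler_prod => b _; apply/andP; split.
    have [->|Cx] := eqVneq (X i w (f i b)) 0; first by rewrite dot0r.
    by have [_ /(_ _ Cx)/ltW] := pB i.
  by rewrite ler_pdivlMl// -dE dot_BLop_ge_term.
have numB := prod_powR_le (fun i => ltW (p0 i)) kap0 d0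
  (fun i => ltW (detl_gt0 (pB i))) detB.
have detM : detl (M B) * \det (gram H) = expR (\sum_k ln (d 0 k)).
  rewrite -det_formmx (pdmx_ldl_det w2 FB) expR_sum.
  by apply: eq_bigr => k _; rewrite lnK ?posrE.
have gH := det_gram_gt0 H.
rewrite /BL_ratio -/(M B) ler_pdivrMr ?detl_gt0//; apply: le_trans numB _.
rewrite -!mulrA ler_wpM2l ?prodr_ge0//; first by move=> i _; apply: powR_ge0.
rewrite [leRHS]mulrC -mulrA detM -expRD ler_expR -lerBlDr -sumrB.
by apply: le_trans xK1; apply: ler_sum => k _; rewrite mulrBl mul1r.
Unshelve. all: end_near.
Qed.

(** The local bounds are made uniform by compactness: near each basis every large
    enough [K] is a bound, hence some [K] is a bound for all bases at once. *)
Lemma BL_finite_sufficient : (BL C p Q QH < +oo)%E.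
Proof.
apply/BL_bounded.
have [c c0 ldl] := pdmx_ldl_incr R N.
have [K hK] : exists K, forall w : 'rV[R]_(N * N),
    (forall i, `|w 0 i| <= c) -> \det (vec_mx w) ^+ 2 = 1 -> ratio_bound K w.
  have := @compact_bounded_det1 R N c.
  move=> /compact_near_coveringP/near_covering_withinP.
  move=> /(_ R (pinfty_nbhs R) ratio_bound _)[].
    move=> w0 [wc w1]; have [K0 nK0] := local_bound w1.
    near=> w K => -[_ w2].
    have K0K : K0 <= K by near: K; exact: nbhs_pinfty_ge (num_real _).
    have rK0 : ratio_bound K0 w by apply: (near nK0 w).
    move=> B aB d FB dd; exact: le_trans (rK0 _ aB _ FB dd) K0K.
  move=> K [_ hK]; exists (K + 1) => w wc w1.
  by apply: (hK (K + 1)); rewrite ?ltrDl.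
exists K => B aB.
have pM : posdef (M B) by apply: (posdef_BLop datum) => // i; have [] := aB i.
have [F [d [F1 Fc FM dd]]] := ldl _ (pdmx_formmx pM).
apply: (hK (mxvec F) _ _ _ aB d) => //; rewrite ?mxvecK//.
by move=> k; case/mxvec_indexP: k => i j; rewrite mxvecE.
Unshelve. all: end_near.
Qed.

End Sufficiency.

Theorem theorem3p2 (R : realType) (m : nat) (H : euclidean R)
    (Hs : 'I_m -> euclidean R) (C : forall i, 'Hom(H, Hs i)) (p : 'I_m -> R)
    (Q : forall i, 'End(Hs i)) (datum : gBL_datum C p Q) :
  ((BL C p Q 0%R < +oo)%E <->
    forall V : {vspace H},
      (\dim V)%:R <= \sum_(j < m) p j * (\dim (C j @: V)%VS)%:R) /\
  (forall QH : 'End(H), psd QH -> ~ posdef QH ->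
    ((BL C p Q QH < +oo)%E <->
      forall V : {vspace H}, (V <= lker QH)%VS ->
        (\dim V)%:R <= \sum_(j < m) p j * (\dim (C j @: V)%VS)%:R)).
Proof.
have main QH : psd QH -> (BL C p Q QH < +oo)%E <->
    forall V : {vspace H}, (V <= lker QH)%VS ->
      (\dim V)%:R <= \sum_(j < m) p j * (\dim (C j @: V)%VS)%:R.
  move=> pQ; split=> [fin V VQ|]; first exact: (BL_finite_necessary datum pQ fin VQ).
  exact: (BL_finite_sufficient datum pQ).
split=> [|QH pQ _]; last exact: main.
have psd0 : psd (0 : 'End(H)).
  split=> [x y|x]; first by rewrite !zero_lfunE dot0l dot0r.
  by rewrite zero_lfunE dot0l.
have ker0 (V : {vspace H}) : (V <= lker (0%R : 'End(H)))%VS.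
  by apply/subvP => x _; rewrite memv_ker zero_lfunE.
have [nec suf] := main _ psd0; split=> [fin V|cond]; first exact: nec (ker0 V).
by apply: suf => V _; apply: cond.
Qed.
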